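(* Let $\Omega\subset\mathbb{R}^d$, let $K:\Omega\times\Omega\to\mathbb{R}$ be a strictly positive definite kernel, let $X=\{x_1,\ldots,x_N\}\subset\Omega$ be a set of $N$ distinct points, and assume that the kernel interpolant $P_g$ on $X$ of the constant function $g\equiv 1$ does not vanish at any point of $\Omega$. Let $a\in\mathbb{R}\setminus\{0\}$ and let $f:\Omega\to\mathbb{R}\setminus\{0\}$ be the constant function $f(x)=a$ for all $x\in\Omega$. Then the rescaled interpolant $\hat P_f = P_f/P_g$ of $f$ on $X$ satisfies $\hat P_f(x)=a$ for all $x\in\Omega$.
   Context: A kernel $K:\Omega\times\Omega\to\mathbb{R}$ is strictly positive definite if it is symmetric and, for every finite set of distinct points of $\Omega$, the matrix of values of $K$ on pairs of these points is positive definite. For a function $f:\Omega\to\mathbb{R}$ and a set $X=\{x_1,\ldots,x_N\}\subset\Omega$ of distinct points, the kernel interpolant of $f$ on $X$ is $$P_f(x)=\sum_{i=1}^N c_i K(x,x_i),\qquad x\in\Omega,$$ where $c=(c_1,\ldots,c_N)^T$ is the unique solution of the linear system $Ac=(f(x_1),\ldots,f(x_N))^T$ with $A_{i,j}=K(x_i,x_j)$. Let $g:\Omega\to\mathbb{R}$, $g\equiv 1$, so that $P_g(x)=\sum_{i=1}^N d_iK(x,x_i)$ with $Ad=(1,\ldots,1)^T$. The rescaled interpolant of $f$ on $X$ is $$\hat P_f(x)=\frac{P_f(x)}{P_g(x)},\qquad x\in\Omega,$$ which is defined when $P_g$ does not vanish on $\Omega$. *)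

(* Defs.v *)
From HB Require Import structures.
From mathcomp Require Import all_boot all_order all_algebra.
From mathcomp Require Import boolp classical_sets reals.

Set Implicit Arguments.
Unset Strict Implicit.
Unset Printing Implicit Defensive.

Import Order.TTheory GRing.Theory Num.Theory.

Local Open Scope ring_scope.
Local Open Scope classical_set_scope.

Definition positive_definite (R : realType) (n : nat) (A : 'M[R]_n) : Prop :=
  A^T = A /\ forall v : 'cV[R]_n, v != 0 -> 0 < (v^T *m A *m v) 0 0.

Definition kernel_matrix (R : realType) (T : Type) (K : T -> T -> R)
    (N : nat) (x : 'I_N -> T) : 'M[R]_N :=
  \matrix_(i < N, j < N) K (x i) (x j).

(* Finite sets of distinct points are given by injective enumerations. *)
Definition strictly_positive_definite (R : realType) (T : Type)
    (K : T -> T -> R) : Prop :=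
  (forall s t : T, K s t = K t s) /\
  (forall (n : nat) (x : 'I_n -> T),
     injective x -> positive_definite (kernel_matrix K x)).

(* The solution c of A c = (f x_1, ..., f x_N)^T. It exists and is unique when
   K is strictly positive definite and x is injective; the default value 0 is
   taken only if the system has no solution. *)
Definition interpolation_coefficients (R : realType) (T : Type)
    (K : T -> T -> R) (N : nat) (x : 'I_N -> T) (f : T -> R) : 'cV[R]_N :=
  xget 0 [set c : 'cV[R]_N | kernel_matrix K x *m c = \col_(i < N) f (x i)].

Definition interpolant (R : realType) (T : Type) (K : T -> T -> R)
    (N : nat) (x : 'I_N -> T) (f : T -> R) (t : T) : R :=
  \sum_(i < N) interpolation_coefficients K x f i 0 * K t (x i).

(* Meaningful only where the interpolant of the constant function 1 is nonzero. *)
Definition rescaled_interpolant (R : realType) (T : Type) (K : T -> T -> R)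
    (N : nat) (x : 'I_N -> T) (f : T -> R) (t : T) : R :=
  interpolant K x f t / interpolant K x (fun=> 1) t.

(* Main.v *)
Require Import Defs.
From HB Require Import structures.
From mathcomp Require Import all_boot all_order all_algebra.
From mathcomp Require Import boolp classical_sets reals.

Set Implicit Arguments.
Unset Strict Implicit.
Unset Printing Implicit Defensive.

Import Order.TTheory GRing.Theory Num.Theory.

Local Open Scope ring_scope.
Local Open Scope classical_set_scope.

(** Interpolation is linear in the data: the kernel matrix is invertible, so the coefficients are
    its inverse applied to the sampled values. Since f is a times the constant 1, its interpolant is
    a times that of 1 at every point, and the quotient is a wherever the denominator is nonzero.
    [interpolant_scale] carries the argument. *)

Lemma positive_definite_unitmx (R : realType) (n : nat) (A : 'M[R]_n) :
  positive_definite A -> A \in unitmx.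
Proof.
(* A nonzero row [u] with [u *m A = 0] would make the quadratic form vanish at [u^T], against
   positivity. *)
move=> [_ A_gt0]; rewrite -row_free_unit -kermx_eq0; apply/rowV0P => u.
move=> /sub_kermxP uA0; apply/eqP/negPn/negP => u_neq0.
have := A_gt0 u^T; rewrite trmx_eq0 trmxK uA0 mul0mx mxE ltxx.
by move=> /(_ u_neq0).
Qed.

Lemma interpolation_coefficientsE (R : realType) (T : Type) (K : T -> T -> R)
    (N : nat) (x : 'I_N -> T) (f : T -> R) :
  strictly_positive_definite K -> injective x ->
  interpolation_coefficients K x f =
    invmx (kernel_matrix K x) *m \col_(i < N) f (x i).
Proof.
move=> [_ K_pd] /K_pd/positive_definite_unitmx A_unit.
(* Invertibility gives both existence and uniqueness of the solution, so the default 0 of [xget]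
   never intervenes. *)
apply: xget_unique; first by rewrite /= mulKVmx.
by move=> c /= <-; rewrite mulKmx.
Qed.

Lemma interpolant_scale (R : realType) (T : Type) (K : T -> T -> R)
    (N : nat) (x : 'I_N -> T) (a : R) (f g : T -> R) (t : T) :
  strictly_positive_definite K -> injective x ->
  (forall s, f s = a * g s) ->
  interpolant K x f t = a * interpolant K x g t.
Proof.
move=> K_spd x_inj fE; rewrite /interpolant !interpolation_coefficientsE //.
(* The scalar leaves the data vector, then passes through the inverse matrix and the sum. *)
have -> : \col_(i < N) f (x i) = a *: \col_(i < N) g (x i).
  by apply/colP => i; rewrite !mxE fE.
by rewrite -scalemxAr mulr_sumr; apply: eq_bigr => i _; rewrite mxE mulrA.
Qed.

Theorem theorem2 (R : realType) (d : nat) (Omega : set 'rV[R]_d)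
    (K : Omega -> Omega -> R) (K_spd : strictly_positive_definite K)
    (N : nat) (x : 'I_N -> Omega) (x_inj : injective x)
    (Pg_neq0 : forall t : Omega, interpolant K x (fun=> 1) t != 0)
    (a : R) (a_neq0 : a != 0)
    (f : Omega -> R) (f_const : forall t : Omega, f t = a) :
  forall t : Omega, rescaled_interpolant K x f t = a.
Proof.
move=> t; rewrite /rescaled_interpolant.
(* With g = 1 the numerator becomes a times the denominator, which [Pg_neq0] allows to cancel. *)
rewrite (@interpolant_scale _ _ K N x a f (fun=> 1)) ?mulfK //.
by move=> s; rewrite f_const mulr1.
Qed.
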